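(* The elementary symmetric functions $\{e_\alpha : \alpha \text{ is an atomic set partition}\}$ in $\mathrm{NCSym}$ are algebraically independent over $\mathbb{Q}$ and freely generate $\mathrm{NCSym}$.
   Context: Let $x_1,x_2,\dots$ be noncommuting variables and $[n]=\{1,\dots,n\}$. A set partition $\pi=B_1/\cdots/B_\ell\vdash[n]$ is a family of disjoint nonempty sets (blocks) with union $[n]$. For $\pi\vdash[n]$, $n\ge1$, define (sums over tuples of positive integers): $m_\pi=\sum x_{i_1}\cdots x_{i_n}$ over tuples with $i_j=i_k$ if and only if $j,k$ are in the same block of $\pi$; and the elementary symmetric function $e_\pi=\sum x_{i_1}\cdots x_{i_n}$ over tuples with $i_j\neq i_k$ whenever $j\ne k$ are in the same block of $\pi$. $\mathrm{NCSym}=\bigoplus_{n\ge0}\mathrm{NCSym}^n\subset\mathbb{Q}\langle\langle x_1,x_2,\dots\rangle\rangle$ is the graded algebra with $\mathrm{NCSym}^0=\mathbb{Q}\cdot1$ and $\mathrm{NCSym}^n=\mathrm{span}_{\mathbb{Q}}\{m_\pi:\pi\vdash[n]\}$ for $n\ge1$. The set $\{e_\pi:\pi\vdash[n]\}$ is also a basis of $\mathrm{NCSym}^n$. For $\pi\vdash[n]$ and $\sigma=B_1/\cdots/B_\ell\vdash[m]$, the slash product is $\pi\mid\sigma=\pi/(B_1+n)/\cdots/(B_\ell+n)\vdash[n+m]$, where $B+n=\{b+n:b\in B\}$. A (nonempty) set partition $\pi$ is atomic if there do not exist nonempty set partitions $\sigma_1,\sigma_2$ with $\pi=\sigma_1\mid\sigma_2$.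 Here generation and independence are in the noncommutative sense: the elements satisfy no nontrivial noncommutative polynomial relation over $\mathbb{Q}$, and $\mathrm{NCSym}$ is the free associative unital $\mathbb{Q}$-algebra on them. *)

(* Defs.v *)
From HB Require Import structures.
From mathcomp Require Import boolp classical_sets functions.
From mathcomp Require Import all_boot all_order all_algebra.
From mathcomp Require Import finmap.
From mathcomp.multinomials Require Import monalg.

Set Implicit Arguments.
Unset Strict Implicit.
Unset Printing Implicit Defensive.

Import GRing.Theory.
Local Open Scope ring_scope.

(* The algebra Q<<x_1, x_2, ...>> of noncommutative formal power series.      *)
(* The letter [i : nat] stands for the variable x_(i+1), a word [w : seq nat] *)
(* for a monomial, and a series is its coefficient function.  The vector      *)
(* space structure is the pointwise one; the product is the convolution over  *)
(* all factorizations of a word.                                              *)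
Definition ncseries : Type := seq nat -> rat.

HB.instance Definition _ := GRing.Lmodule.copy ncseries (seq nat -> rat^o).

Definition ncseries_one : ncseries := fun w => (w == [::])%:R.

Definition ncseries_mul (f g : ncseries) : ncseries :=
  fun w => \sum_(i < (size w).+1) f (take i w) * g (drop i w).

Section NCSeriesRing.
Implicit Types f g h : ncseries.

Let addE f g w : (f + g) w = f w + g w. Proof. by []. Qed.
Let scaleE (a : rat) f w : (a *: f) w = a * f w. Proof. by []. Qed.

Fact ncseries_mulA : associative ncseries_mul.
Proof.
move=> f g h; apply/funext => w; rewrite /ncseries_mul.
pose F i j := f (take i w) * g (take j (drop i w)) * h (drop (i + j) w).
transitivity (\sum_(0 <= i < (size w).+1) \sum_(0 <= j < (size w - i).+1) F i j).
  rewrite big_mkord; apply: eq_bigr => i _; rewrite size_drop big_mkord mulr_sumr.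
  by apply: eq_bigr => j _; rewrite /F mulrA drop_drop addnC.
transitivity (\sum_(0 <= k < (size w).+1) \sum_(0 <= i < k.+1) F i (k - i)%N).
  transitivity (\sum_(0 <= i < (size w).+1)
      \sum_(0 <= k < (size w).+1 | (i <= k)%N) F i (k - i)%N).
    rewrite big_nat [RHS]big_nat; apply: eq_bigr => i; rewrite /= ltnS => le_i.
    rewrite [RHS](big_cat_nat _ (n := i)) ?leqW //=.
    rewrite [X in _ = X + _]big1_seq ?add0r; last first.
      move=> k /andP[le_ik]; rewrite mem_index_iota => /andP[_ lt_ki].
      by rewrite leqNgt lt_ki in le_ik.
    have -> : \sum_(i <= k < (size w).+1 | (i <= k)%N) F i (k - i)%N =
        \sum_(0 <= j < (size w).+1 - i | (i <= j + i)%N) F i (j + i - i)%N.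
      by rewrite -{1}[i]add0n big_addn.
    rewrite subSn //; symmetry.
    by apply: eq_big => [k|k _]; rewrite ?leq_addl ?addnK.
  rewrite (exchange_big_dep_nat xpredT) //= big_nat [RHS]big_nat.
  apply: eq_bigr => k; rewrite ltnS => le_k.
  rewrite [LHS](big_cat_nat _ (n := k.+1)) //=.
  rewrite [X in _ + X]big1_seq ?addr0; last first.
    move=> i /andP[le_ik]; rewrite mem_index_iota => /andP[lt_ki _].
    by rewrite leqNgt lt_ki in le_ik.
  rewrite big_nat_cond [RHS]big_nat_cond; apply: eq_bigl => i.
  by rewrite ltnS andbT -andbA andbb.
rewrite big_mkord; apply: eq_bigr => k _; rewrite big_mkord mulr_suml size_take.
have -> : (if (k < size w)%N then nat_of_ord k else size w) = k.
  by case: ltnP => // le_k; apply/eqP; rewrite eqn_leq le_k -ltnS ltn_ord.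
apply: eq_bigr => i _.
rewrite /F subnKC -1?ltnS // take_takel -1?ltnS //.
by rewrite take_drop subnK // -ltnS.
Qed.

Fact ncseries_mul1r : left_id ncseries_one ncseries_mul.
Proof.
move=> f; apply/funext => w; rewrite /ncseries_mul big_ord_recl /=.
rewrite take0 drop0 /ncseries_one eqxx mul1r big1 ?addr0 // => i _.
by case: w i => [[]//|x w i] /=; rewrite mul0r.
Qed.

Fact ncseries_mulr1 : right_id ncseries_one ncseries_mul.
Proof.
move=> f; apply/funext => w; rewrite /ncseries_mul big_ord_recr /=.
rewrite take_size drop_size /ncseries_one eqxx mulr1 big1 ?add0r // => i _.
by rewrite -size_eq0 size_drop subn_eq0 leqNgt ltn_ord mulr0.
Qed.

Fact ncseries_mulDl : left_distributive ncseries_mul +%R.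
Proof.
move=> f g h; apply/funext => w; rewrite addE /ncseries_mul -big_split.
by apply: eq_bigr => i _; rewrite addE mulrDl.
Qed.

Fact ncseries_mulDr : right_distributive ncseries_mul +%R.
Proof.
move=> f g h; apply/funext => w; rewrite addE /ncseries_mul -big_split.
by apply: eq_bigr => i _; rewrite addE mulrDr.
Qed.

Fact ncseries_one_neq0 : ncseries_one != 0.
Proof. by apply/eqP => /(congr1 (fun f : ncseries => f [::])). Qed.

HB.instance Definition _ := GRing.Zmodule_isNzRing.Build ncseries
  ncseries_mulA ncseries_mul1r ncseries_mulr1 ncseries_mulDl ncseries_mulDr
  ncseries_one_neq0.

Let mulE f g w :
  (f * g) w = \sum_(i < (size w).+1) f (take i w) * g (drop i w).
Proof. by []. Qed.

Fact ncseries_scaleAl (a : rat) f g : a *: (f * g) = (a *: f) * g.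
Proof.
apply/funext => w; rewrite scaleE !mulE mulr_sumr.
by apply: eq_bigr => i _; rewrite scaleE mulrA.
Qed.

HB.instance Definition _ :=
  GRing.Lmodule_isLalgebra.Build rat ncseries ncseries_scaleAl.

Fact ncseries_scaleAr (a : rat) f g : a *: (f * g) = f * (a *: g).
Proof.
apply/funext => w; rewrite scaleE !mulE mulr_sumr.
by apply: eq_bigr => i _; rewrite scaleE mulrCA.
Qed.

HB.instance Definition _ :=
  GRing.Lalgebra_isAlgebra.Build rat ncseries ncseries_scaleAr.

End NCSeriesRing.

(* Set partitions of [n], represented on 'I_n = {0, ..., n-1}. *)
Definition setpart (n : nat) : Type :=
  {P : {set {set 'I_n}} | partition P [set: 'I_n]%SET}.

HB.instance Definition _ n := Finite.on (setpart n).

Definition same_block n (P : setpart n) (j k : 'I_n) : bool :=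
  [exists B in val P, (j \in B) && (k \in B)].

(* The series $\sum x_{i_1} \cdots x_{i_n}$ over the tuples in [A]. *)
Definition tuple_series n (A : pred (n.-tuple nat)) : ncseries :=
  fun w => if insub w is Some t then (A t)%:R else 0.

Definition ncm n (P : setpart n) : ncseries :=
  tuple_series (fun t : n.-tuple nat =>
    [forall j, forall k, (tnth t j == tnth t k) == same_block P j k]).

Definition nce n (P : setpart n) : ncseries :=
  tuple_series (fun t : n.-tuple nat =>
    [forall j, forall k,
       (j != k) && same_block P j k ==> (tnth t j != tnth t k)]).

(* For n = 0 the only set partition is the empty one, for which [ncm] is 1    *)
(* (see [ncm0]), so that the degree 0 component is Q.1.                       *)
Definition NCSym_deg (n : nat) : set ncseries :=
  [set f : ncseries | exists c : setpart n -> rat, f = \sum_(P : setpart n) c P *: ncm P].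

Definition NCSym : set ncseries :=
  [set f : ncseries | exists (N : nat) (g : nat -> ncseries),
     (forall n, NCSym_deg n (g n)) /\ f = \sum_(n < N) g n].

Lemma ncm0 (P : setpart 0) : ncm P = 1.
Proof.
apply/funext => w; rewrite /ncm /tuple_series [RHS]/GRing.one/= /ncseries_one.
case: insubP => [t /= /eqP/size0nil w0 _|]; last by case: w.
rewrite w0 eqxx; suff -> : [forall j, forall k,
  (tnth t j == tnth t k) == same_block P j k] by [].
by apply/forallP => -[].
Qed.

(* The shift B + n is the image of B under [rshift n : 'I_m -> 'I_(n + m)].   *)
Definition slash_set n m (P : {set {set 'I_n}}) (Q : {set {set 'I_m}}) :
    {set {set 'I_(n + m)}} :=
  ([set @lshift n m @: (B : {set 'I_n}) | B in P] :|:
   [set @rshift n m @: (B : {set 'I_m}) | B in Q])%SET.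

Fact slash_subproof n m (P : setpart n) (Q : setpart m) :
  partition (slash_set (val P) (val Q)) [set: 'I_(n + m)]%SET.
Proof.
case: P Q => [P /= Ppart] [Q /= Qpart].
have [/eqP covP tP nP] := and3P Ppart; have [/eqP covQ tQ nQ] := and3P Qpart.
apply/and3P; split.
- apply/eqP/setP => i; rewrite inE; apply/bigcupP.
  case: (splitP i) => j ij.
  + have : j \in cover P by rewrite covP inE.
    case/bigcupP => B BP jB; exists (@lshift n m @: B)%SET.
      by rewrite inE imset_f.
    by rewrite (_ : i = lshift m j) ?imset_f //; apply: val_inj.
  + have : j \in cover Q by rewrite covQ inE.
    case/bigcupP => B BQ jB; exists (@rshift n m @: B)%SET.
      by rewrite inE [X in _ || X]imset_f ?orbT.
    by rewrite (_ : i = rshift n j) ?imset_f //; apply: val_inj.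
- apply/trivIsetP => A B; rewrite !inE.
  case/orP=> /imsetP[A' A'P ->]; case/orP=> /imsetP[B' B'P ->] neqAB.
  + rewrite imset_disjoint; last exact: lshift_inj.
    by apply: (trivIsetP tP) => //; apply: contraNneq neqAB => ->.
  + rewrite disjoint_subset; apply/fintype.subsetP => x /imsetP[a _ ->].
    by rewrite inE; apply/imsetP => -[b _ /eqP]; rewrite eq_lrshift.
  + rewrite disjoint_subset; apply/fintype.subsetP => x /imsetP[a _ ->].
    by rewrite inE; apply/imsetP => -[b _ /eqP]; rewrite eq_rlshift.
  + rewrite imset_disjoint; last exact: rshift_inj.
    by apply: (trivIsetP tQ) => //; apply: contraNneq neqAB => ->.
- rewrite inE negb_or; apply/andP; split; apply/imsetP => -[B BP /esym/eqP];
    rewrite imset_eq0 => /eqP B0; move: BP; rewrite B0.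
  + by rewrite (negbTE nP).
  + by rewrite (negbTE nQ).
Qed.

Definition slash n m (P : setpart n) (Q : setpart m) : setpart (n + m) :=
  exist _ (slash_set (val P) (val Q)) (slash_subproof P Q).

Definition any_setpart : Type := {n : nat & setpart n}.

HB.instance Definition _ := Countable.on any_setpart.

(* A set partition of [n] is nonempty iff n > 0. *)
Definition atomic (s : any_setpart) : Prop :=
  (0 < tag s)%N /\
  ~ exists (n m : nat) (P : setpart n) (Q : setpart m),
      [/\ (0 < n)%N, (0 < m)%N & s = Tagged setpart (slash P Q)].

Definition atomic_setpart : Type := {s : any_setpart | `[< atomic s >]}.

HB.instance Definition _ := Countable.on atomic_setpart.

Definition nce_atomic (a : atomic_setpart) : ncseries := nce (tagged (val a)).

(* The free associative unital algebra R<X_i : i in I>, as the algebra of the *)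
(* free monoid {fmonom I}: its elements are the noncommutative polynomials.   *)
Notation free_alg R I := {malg R[{fmonom I}]}.

Section NCPolynomials.
Context {R : comNzRingType} {I : choiceType} {A : algType R}.
Implicit Types (g : I -> A) (p : free_alg R I).

Definition free_alg_eval g p : A :=
  \sum_(w <- msupp p) p@_w *: \prod_(i <- (w : seq I)) g i.

Definition nc_alg_independent g : Prop :=
  forall p, free_alg_eval g p = 0 -> p = 0.

(* The evaluation R<X_i : i in I> -> A, which is a morphism of algebras (see  *)
(* [free_alg_eval_is_linear], [free_alg_eval_is_monoid_morphism]), is an      *)
(* isomorphism onto S.                                                        *)
Definition nc_freely_generates g (S : set A) : Prop :=
  set_bij [set: free_alg R I] S (free_alg_eval g).

Definition word_prod g (w : {fmonom I}) : A := \prod_(i <- (w : seq I)) g i.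

Fact word_prod_mmorphism g : mmorphism (word_prod g).
Proof.
by split=> [v w|]; rewrite /word_prod ?fm1 ?fmM ?big_nil ?big_cat.
Qed.

HB.instance Definition _ g :=
  isMultiplicative.Build {fmonom I} A (word_prod g) (word_prod_mmorphism g).

Lemma free_alg_evalE g p : free_alg_eval g p = mmap (in_alg A) (word_prod g) p.
Proof. by apply: eq_bigr => w _; rewrite /= mulr_algl. Qed.

Lemma free_alg_eval_is_linear g : linear (free_alg_eval g).
Proof. by move=> a p q; rewrite !free_alg_evalE mmapD mmapZ /= mulr_algl. Qed.

Lemma free_alg_eval_is_monoid_morphism g : monoid_morphism (free_alg_eval g).
Proof.
have [mmM mm1] : multiplicative (mmap (in_alg A) (word_prod g)).
  apply: commr_mmap_is_multiplicative => p v w.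
  by rewrite /GRing.comm /= mulr_algl mulr_algr.
by split=> [|p q]; rewrite !free_alg_evalE.
Qed.

End NCPolynomials.

(* Main.v *)
(* Concatenating words gives e_(P | Q) = e_P e_Q, and every set partition is   *)
(* in a unique way a slash product of atomic ones, so the products of the      *)
(* e_a, a atomic, are exactly the e_P, and it remains to see that the e_P are  *)
(* a basis.  Let p_Q be the sum of the words that are constant on the blocks   *)
(* of Q.  For a tuple t, the sum of the signs of the permutations of the       *)
(* positions that preserve the blocks of P and fix t is 1 if t is injective on *)
(* the blocks of P, and otherwise 0.  Hence e_P = \sum_s (-1)^s p_(orbits s),  *)
(* the sum over the permutations s preserving the blocks of P.  The            *)
(* permutations with a given orbit partition have the same sign, so the        *)
(* coefficient of p_P does not vanish and the transition from p to e is        *)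
(* triangular; so is the one from m to p.                                      *)
From HB Require Import structures.
Require Import Defs.
From mathcomp Require Import boolp classical_sets functions.
From mathcomp Require Import all_boot all_order all_algebra all_fingroup.
From mathcomp Require Import finmap.
From mathcomp.multinomials Require Import monalg.
From mathcomp Require Import zify.

Set Implicit Arguments.
Unset Strict Implicit.
Unset Printing Implicit Defensive.

Import GRing.Theory Num.Theory.
Local Open Scope ring_scope.

(** * Set partitions as equivalence relations *)

(** Words in the atoms correspond bijectively to set partitions ([slash_word_inj],
    [slash_word_surj]), and [nce_slash] turns slash products into products of series. So evaluation
    sends the monomial of a word to the [nce] of its slash product ([word_prod_nce]): it matches the
    monomial basis of the free algebra with the family of all e_P. Injectivity and surjectivity thus
    reduce, degree by degree, to [nce_free] and [ncm_in_span_nce].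

    Both follow from two changes of basis that are triangular for refinement, m to p ([ncp_ncm]) and
    p to e ([nce_ncp]), by [triangular_free] and [triangular_span]. The signed sum over permutations
    in [perm_expansion] gives the second one, and [nce_coef_diag] its nonzero diagonal. *)

Section SameBlock.
Context {n : nat}.
Implicit Types (P Q : setpart n) (i j k : 'I_n).

Let cover_setpart P i : i \in cover (val P).
Proof. by have /and3P[/eqP-> _ _] := valP P; rewrite inE. Qed.

Lemma same_blockE P i j : same_block P i j = (j \in pblock (val P) i).
Proof.
have /and3P[_ tP _] := valP P.
apply/existsP/idP => [[B /and3P[BP iB jB]]|jPi].
  by rewrite (def_pblock tP BP iB).
exists (pblock (val P) i).
by rewrite (pblock_mem (cover_setpart P i)) mem_pblock cover_setpart.
Qed.

Lemma same_block_pblock P i j :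
  same_block P i j = (pblock (val P) i == pblock (val P) j).
Proof.
by have /and3P[_ tP _] := valP P; rewrite eq_pblock ?cover_setpart// same_blockE.
Qed.

Lemma same_block_refl P i : same_block P i i.
Proof. by rewrite same_block_pblock. Qed.

Lemma same_block_sym P i j : same_block P i j = same_block P j i.
Proof. by rewrite !same_block_pblock eq_sym. Qed.

Lemma same_block_trans P i j k :
  same_block P i j -> same_block P j k -> same_block P i k.
Proof. by rewrite !same_block_pblock => /eqP->. Qed.

Lemma setpart_ext P Q : same_block P =2 same_block Q -> P = Q.
Proof.
move=> eqPQ; apply: val_inj.
rewrite -(preim_partition_pblock (valP P)) -(preim_partition_pblock (valP Q)).
rewrite /preim_partition /equivalence_partition.
apply: eq_imset => i; apply/setP => j; rewrite !inE.
by rewrite -!same_block_pblock eqPQ.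
Qed.

Section Kernel.
Context {T : eqType}.
Implicit Types t : 'I_n -> T.

(** The kernel of a tuple singles out the one m_P in which its word occurs ([ncm_tuple]). Orbit
    partitions and restrictions to an interval are also built as kernels. *)
Definition kerpart t : setpart n :=
  exist _ (preim_partition t [set: 'I_n]%SET) (preim_partitionP t _).

Lemma same_block_kerpart t i j : same_block (kerpart t) i j = (t i == t j).
Proof.
rewrite same_blockE /= pblock_equivalence_partition ?inE//.
by split => // /eqP->.
Qed.

End Kernel.

Lemma setpart_kernel P : exists t : 'I_n -> nat, P = kerpart t.
Proof.
exists (fun i => nat_of_ord (enum_rank (pblock (val P) i))); apply: setpart_ext => i j.
by rewrite same_block_kerpart same_block_pblock (inj_eq val_inj) (inj_eq enum_rank_inj).
Qed.

(** Refinement of partitions becomes inclusion of these sets, and their cardinality supplies the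
    rank for the triangularity arguments. *)
Definition block_pairs P : {set 'I_n * 'I_n} := [set u | same_block P u.1 u.2].

Lemma block_pairs_inj : injective block_pairs.
Proof.
by move=> P Q /setP eqPQ; apply: setpart_ext => i j; have := eqPQ (i, j); rewrite !inE.
Qed.

Lemma block_pairs_subP P Q :
  reflect (forall i j, same_block P i j -> same_block Q i j)
          (block_pairs P \subset block_pairs Q).
Proof.
apply: (iffP fintype.subsetP) => [sub i j|sub [i j]]; last by rewrite !inE; apply: sub.
by have := sub (i, j); rewrite !inE.
Qed.

Lemma block_pairs_proper P Q :
  block_pairs P \subset block_pairs Q -> P != Q ->
  (#|block_pairs P| < #|block_pairs Q|)%N.
Proof.
move=> sub neq; apply: proper_card; rewrite finset.properEneq sub andbT.
by apply: contraNneq neq => /block_pairs_inj ->.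
Qed.

End SameBlock.

(** * The slash product and its unique factorization into atoms *)

Lemma same_block_slash n m (P : setpart n) (Q : setpart m) (i j : 'I_(n + m)) :
  same_block (slash P Q) i j =
  match split i, split j with
  | inl i', inl j' => same_block P i' j'
  | inr i', inr j' => same_block Q i' j'
  | _, _ => false
  end.
Proof.
rewrite -[i in LHS]splitK -[j in LHS]splitK.
case: (split i) => i'; case: (split j) => j' /=.
- apply/existsP/existsP => -[B /andP[]].
    rewrite inE => /orP[] /imsetP[B' B'P ->{B}].
      by rewrite !(mem_imset _ _ (@lshift_inj _ _)) => ij; exists B'; rewrite B'P.
    by move=> /andP[/imsetP[x _ /eqP]]; rewrite eq_lrshift.
  move=> BP ij; exists (@lshift n m @: B)%SET.
  by rewrite inE imset_f //= !(mem_imset _ _ (@lshift_inj _ _)).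
- apply/negbTE/existsP => -[B /and3P[]]; rewrite inE => /orP[] /imsetP[B' _ ->{B}].
    by move=> _ /imsetP[x _ /eqP]; rewrite eq_rlshift.
  by move=> /imsetP[x _ /eqP]; rewrite eq_lrshift.
- apply/negbTE/existsP => -[B /and3P[]]; rewrite inE => /orP[] /imsetP[B' _ ->{B}].
    by move=> /imsetP[x _ /eqP]; rewrite eq_rlshift.
  by move=> _ /imsetP[x _ /eqP]; rewrite eq_lrshift.
- apply/existsP/existsP => -[B /andP[]].
    rewrite inE => /orP[] /imsetP[B' B'P ->{B}].
      by move=> /andP[/imsetP[x _ /eqP]]; rewrite eq_rlshift.
    by rewrite !(mem_imset _ _ (@rshift_inj _ _)) => ij; exists B'; rewrite B'P.
  move=> BP ij; exists (@rshift n m @: B)%SET.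
  by rewrite inE [X in _ || X]imset_f ?orbT //= !(mem_imset _ _ (@rshift_inj _ _)).
Qed.

(* Indexing by natural numbers rather than by ['I_(tag s)] avoids casts between *)
(* ['I_(n + (m + k))] and ['I_(n + m + k)]; the relation is false out of range. *)
Definition linked (s : any_setpart) (i j : nat) : bool :=
  match insub i, insub j with
  | Some i', Some j' => same_block (tagged s) i' j'
  | _, _ => false
  end.

Lemma linked_ord n (P : setpart n) (i j : 'I_n) :
  linked (Tagged setpart P) i j = same_block P i j.
Proof. by rewrite /linked !valK. Qed.

Lemma linked_ltl s i j : linked s i j -> (i < tag s)%N.
Proof. by rewrite /linked; case: insubP. Qed.

Lemma linked_sym s i j : linked s i j = linked s j i.
Proof. by rewrite /linked; do 2!case: insub => [?|] //; rewrite same_block_sym. Qed.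

Lemma linked_outl s i j : (tag s <= i)%N -> linked s i j = false.
Proof. by rewrite leqNgt; apply: contraNF => /linked_ltl. Qed.

Lemma linked_outr s i j : (tag s <= j)%N -> linked s i j = false.
Proof. by rewrite linked_sym; apply: linked_outl. Qed.

Lemma any_setpart_ext (s t : any_setpart) :
  tag s = tag t -> linked s =2 linked t -> s = t.
Proof.
case: s t => [n P] [m Q] /= nm; case: m / nm in Q * => eqPQ; congr Tagged.
by apply: setpart_ext => i j; have := eqPQ i j; rewrite !linked_ord.
Qed.

Definition aslash (s t : any_setpart) : any_setpart :=
  Tagged setpart (slash (tagged s) (tagged t)).

Lemma linked_aslash s t i j :
  linked (aslash s t) i j =
  if (i < tag s)%N then linked s i j
  else (tag s <= j)%N && linked t (i - tag s) (j - tag s).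
Proof.
case: s t => [n P] [m Q] /=.
have [lt_i|ge_i] := ltnP i (n + m); last first.
  by rewrite !linked_outl //=; [rewrite andbF if_same | lia | lia].
have [lt_j|ge_j] := ltnP j (n + m); last first.
  rewrite !linked_outr //=; [by rewrite andbF if_same | lia | lia].
rewrite (linked_ord _ (Ordinal lt_i) (Ordinal lt_j)) same_block_slash.
case: splitP => i' /= ->; case: splitP => j' /= ->.
- by rewrite ltn_ord linked_ord.
- by rewrite ltn_ord linked_outr //= leq_addr.
- by rewrite ltnNge leq_addr /= [(_ <= j')%N]leqNgt ltn_ord.
- by rewrite ltnNge !leq_addr /= !addKn linked_ord.
Qed.

Definition any_setpart0 : any_setpart :=
  Tagged setpart (kerpart (id : 'I_0 -> 'I_0)).

Lemma any_setpart0P s : tag s = 0%N -> s = any_setpart0.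
Proof.
move=> s0; apply: any_setpart_ext => // i j.
by rewrite !linked_outl ?s0.
Qed.

Lemma aslash0s : left_id any_setpart0 aslash.
Proof.
move=> s; apply: any_setpart_ext => //= i j.
by rewrite linked_aslash /= !subn0.
Qed.

Lemma aslashA : associative aslash.
Proof.
move=> s t u; apply: any_setpart_ext => [|i j]; first by rewrite /= addnA.
rewrite !linked_aslash /=.
have [lt_is|le_si] := ltnP i (tag s); first by rewrite (leq_trans lt_is) ?leq_addr.
rewrite -ltn_subLR // !subnDA.
case: ifP => // ge_it; have [le_sj|lt_js] := leqP (tag s) j; first by rewrite leq_subRL.
by symmetry; apply/negbTE; rewrite negb_and -ltnNge (leq_trans lt_js) ?leq_addr.
Qed.

(** If no block crosses the cut at k, the partition is the slash product of its restrictions to the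
    two sides. *)
Lemma linked_split k (s : any_setpart) : (k <= tag s)%N ->
  (forall i j, (i < k <= j)%N -> ~~ linked s i j) ->
  exists (P : setpart k) (Q : setpart (tag s - k)),
    s = Tagged setpart (slash P Q).
Proof.
case: s => [n P] /= le_kn cut.
(* Sending a position to its block in P makes the kernel of f the restriction of P to the first k
   positions; g does the same for the others. *)
pose f (i : 'I_k) := pblock (val P) (widen_ord le_kn i).
have lt_g (i : 'I_(n - k)) : (k + i < n)%N by rewrite -ltn_subRL.
pose g (i : 'I_(n - k)) := pblock (val P) (Ordinal (lt_g i)).
exists (kerpart f), (kerpart g).
rewrite -[RHS]/(aslash (Tagged setpart (kerpart f)) (Tagged setpart (kerpart g))).
apply: any_setpart_ext => [|i j]; first by rewrite /= subnKC.
rewrite linked_aslash /=.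
have [lt_i|ge_i] := ltnP i n; last first.
  by rewrite !linked_outl //= ?andbF; [case: ifP | lia | lia].
have [lt_j|ge_j] := ltnP j n; last first.
  by rewrite !linked_outr //= ?andbF; [case: ifP | lia | lia].
have [lt_ik|le_ki] := ltnP i k; have [lt_jk|le_kj] := ltnP j k.
- rewrite (linked_ord _ (Ordinal lt_ik) (Ordinal lt_jk)) same_block_kerpart.
  rewrite (linked_ord _ (Ordinal lt_i) (Ordinal lt_j)) same_block_pblock.
  by congr (pblock _ _ == pblock _ _); apply: val_inj.
- rewrite [RHS]linked_outr //=; apply/negbTE; apply: cut; lia.
- rewrite /= linked_sym; apply/negbTE; apply: cut; lia.
- have lt_ik : (i - k < n - k)%N by lia.
  have lt_jk : (j - k < n - k)%N by lia.
  rewrite (linked_ord _ (Ordinal lt_ik) (Ordinal lt_jk)) same_block_kerpart.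
  rewrite (linked_ord _ (Ordinal lt_i) (Ordinal lt_j)) same_block_pblock /=.
  by congr (pblock _ _ == pblock _ _); apply: val_inj; rewrite /= subnKC.
Qed.

Lemma atomic_linked s k : atomic s -> (0 < k < tag s)%N ->
  exists i j, (i < k <= j)%N && linked s i j.
Proof.
move=> [_ atom_s] /andP[k0 ks]; apply: contrapT => nolink; apply: atom_s.
have [|P [Q sPQ]] := @linked_split k s (ltnW ks).
  by move=> i j ij; apply/negP => lij; apply: nolink; exists i, j; rewrite ij.
by exists k, (tag s - k)%N, P, Q; rewrite subn_gt0.
Qed.

(** Were a shorter than b, atomicity of b would give a link across the cut at [tag a], where a slash
    product starting with a has none. *)
Lemma aslash_atomic_leq a b s t : atomic b -> (0 < tag a)%N ->
  aslash a s = aslash b t -> (tag b <= tag a)%N.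
Proof.
move=> atom_b a0 eq_ab; rewrite leqNgt; apply/negP => lt_ab.
have [|i [j /andP[/andP[lt_ia le_aj] lij]]] := @atomic_linked b (tag a) atom_b.
  by rewrite a0.
have := congr1 (fun u => linked u i j) eq_ab; rewrite /= !linked_aslash lt_ia.
by rewrite (ltn_trans lt_ia lt_ab) lij linked_outr.
Qed.

(** By symmetry of the previous bound the first factors have equal size, so both products are cut at
    the same place and can be compared side by side. *)
Lemma aslash_atomic_inj a b s t : atomic a -> atomic b ->
  aslash a s = aslash b t -> a = b /\ s = t.
Proof.
move=> atom_a atom_b eq_ab.
have tag_ab : tag a = tag b.
  apply/eqP; rewrite eqn_leq.
  rewrite (aslash_atomic_leq atom_a _ (esym eq_ab)) ?(proj1 atom_b) //.
  by rewrite (aslash_atomic_leq atom_b _ eq_ab) ?(proj1 atom_a).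
have eq_link i j := congr1 (fun u => linked u i j) eq_ab.
split.
  apply: any_setpart_ext => // i j.
  have := eq_link i j; rewrite !linked_aslash -tag_ab.
  by case: ltnP => // ge_i _; rewrite !linked_outl // -tag_ab.
apply: any_setpart_ext => [|i j].
  by have /eqP := congr1 (fun u : any_setpart => tag u) eq_ab; rewrite /= tag_ab eqn_add2l => /eqP.
have := eq_link (tag a + i)%N (tag a + j)%N.
by rewrite !linked_aslash -tag_ab ltnNge !leq_addr /= !addKn.
Qed.

Definition slash_word (w : seq atomic_setpart) : any_setpart :=
  foldr (fun a => aslash (val a)) any_setpart0 w.

Lemma slash_word_cat v w :
  slash_word (v ++ w) = aslash (slash_word v) (slash_word w).
Proof. by elim: v => [|a v IHv] /=; rewrite ?aslash0s ?IHv ?aslashA. Qed.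

Lemma atomicP (a : atomic_setpart) : atomic (val a).
Proof. exact/asboolP/(valP a). Qed.

(** First atoms cancel one at a time; a nonempty word never gives the empty partition because atoms
    have positive size. *)
Lemma slash_word_inj : injective slash_word.
Proof.
elim=> [|a v IHv] [|b w] //= eq_vw.
- have := congr1 (fun u : any_setpart => tag u) eq_vw; have := proj1 (atomicP b) => /=; lia.
- have := congr1 (fun u : any_setpart => tag u) eq_vw; have := proj1 (atomicP a) => /=; lia.
have [/val_inj-> /IHv->//] := aslash_atomic_inj (atomicP a) (atomicP b) eq_vw.
Qed.

(** Strong induction on the size: a nonempty partition is an atom, hence a one-letter word, or
    splits into two smaller factors. *)
Lemma slash_word_surj s : exists w, slash_word w = s.
Proof.
have [n] := ubnP (tag s); elim: n s => // n IHn s; rewrite ltnS => le_sn.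
have [s0|s_gt0] := posnP (tag s); first by exists [::]; rewrite (any_setpart0P s0).
have [atom_s|natom_s] := pselect (atomic s).
  have /asboolP atom_s' := atom_s.
  exists [:: exist _ s atom_s'].
  apply: any_setpart_ext => [|i j] /=; first by rewrite addn0.
  rewrite linked_aslash /=; case: ltnP => // ge_i.
  by rewrite !linked_outl // andbF.
have [k [m [P [Q [k0 m0 sPQ]]]]] : exists (n m : nat) (P : setpart n) (Q : setpart m),
    [/\ (0 < n)%N, (0 < m)%N & s = Tagged setpart (slash P Q)].
  by apply: contrapT => nex; apply: natom_s.
have tag_s : tag s = (k + m)%N by rewrite sPQ.
have [|v vP] := IHn (Tagged setpart P); first by rewrite /=; lia.
have [|w wQ] := IHn (Tagged setpart Q); first by rewrite /=; lia.
by exists (v ++ w); rewrite slash_word_cat vP wQ sPQ.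
Qed.

(** * Homogeneous series *)

Lemma tuple_series_size n (A : pred (n.-tuple nat)) w :
  size w != n -> tuple_series A w = 0.
Proof. by move=> sz; rewrite /tuple_series insubN. Qed.

Lemma tuple_series_tuple n (A : pred (n.-tuple nat)) (t : n.-tuple nat) :
  tuple_series A t = (A t)%:R.
Proof. by rewrite /tuple_series valK. Qed.

Definition homogeneous n (f : ncseries) := forall w, size w != n -> f w = 0.

Lemma homogeneous_ext n (f g : ncseries) : homogeneous n f -> homogeneous n g ->
  (forall t : n.-tuple nat, f t = g t) -> f = g.
Proof.
move=> hf hg eqfg; apply/funext => w.
have [sz|sz] := eqVneq (size w) n; last by rewrite hf ?hg.
have /eqP szw := sz; exact: (eqfg (Tuple szw)).
Qed.

Lemma ncseriesZ (a : rat) (f : ncseries) w : (a *: f) w = a * f w.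
Proof. by []. Qed.

Lemma ncseries_sum (I : Type) (r : seq I) (p : pred I) (F : I -> ncseries) w :
  (\sum_(i <- r | p i) F i) w = \sum_(i <- r | p i) F i w.
Proof. by elim/big_rec2: _ => // i x f _ <-. Qed.

Lemma homogeneous_sum n (I : finType) (c : I -> rat) (F : I -> ncseries) :
  (forall i, homogeneous n (F i)) -> homogeneous n (\sum_i c i *: F i).
Proof.
move=> hF w sz; rewrite ncseries_sum big1 // => i _.
by rewrite ncseriesZ hF ?mulr0.
Qed.

Lemma homogeneous_mul n m (f g : ncseries) :
  homogeneous n f -> homogeneous m g -> homogeneous (n + m) (f * g).
Proof.
move=> hf hg w sz; rewrite [LHS]big1 // => i _.
have le_i : (i <= size w)%N by rewrite -ltnS.
have [szi|szi] := eqVneq (size (take i w)) n; last by rewrite hf ?mul0r.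
rewrite hg ?mulr0 // size_drop; move: szi; rewrite size_takel // => szi.
by apply: contraNneq sz => szd; lia.
Qed.

(** Only the cut after the first n letters contributes, since f vanishes on prefixes of any other
    length. *)
Lemma homogeneous_mul_cat n (f g : ncseries) v w :
  homogeneous n f -> size v = n ->
  (f * g) (v ++ w) = f v * g w.
Proof.
move=> hf sv; have lt_n : (n < (size (v ++ w)).+1)%N by rewrite size_cat; lia.
rewrite [LHS](bigD1 (Ordinal lt_n)) //= take_size_cat // drop_size_cat //.
rewrite big1 ?addr0 // => i neq_i.
rewrite hf ?mul0r // size_takel; first by [].
by rewrite -ltnS.
Qed.

(** * Power sums and the expansion of e in them *)

Section Series.
Context {n : nat}.
Implicit Types (P Q : setpart n) (t : n.-tuple nat).

Definition ncp P : ncseries :=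
  tuple_series (fun t => block_pairs P \subset block_pairs (kerpart (tnth t))).

Lemma nce_homogeneous P : homogeneous n (nce P).
Proof. by move=> w; apply: tuple_series_size. Qed.

Lemma ncm_homogeneous P : homogeneous n (ncm P).
Proof. by move=> w; apply: tuple_series_size. Qed.

Lemma ncp_homogeneous P : homogeneous n (ncp P).
Proof. by move=> w; apply: tuple_series_size. Qed.

Lemma ncm_tuple P t : ncm P t = (P == kerpart (tnth t))%:R.
Proof.
rewrite /ncm tuple_series_tuple; congr (nat_of_bool _)%:R.
apply/idP/eqP => [/forallP ker_t|-> {P}].
  apply: setpart_ext => j k; have /forallP/(_ k)/eqP := ker_t j.
  by rewrite same_block_kerpart => ->.
by apply/forallP => j; apply/forallP => k; rewrite same_block_kerpart.
Qed.

Lemma ncp_ncm P :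
  ncp P = \sum_Q (block_pairs P \subset block_pairs Q)%:R *: ncm Q.
Proof.
apply: homogeneous_ext; [exact: ncp_homogeneous | |] => [|t].
  by apply: homogeneous_sum => Q; apply: ncm_homogeneous.
rewrite ncseries_sum (bigD1 (kerpart (tnth t))) //= big1 => [|Q /negbTE neqQ].
  by rewrite addr0 ncseriesZ ncm_tuple eqxx mulr1 /ncp tuple_series_tuple.
by rewrite ncseriesZ ncm_tuple neqQ mulr0.
Qed.

(** Evaluating the relation at a tuple with kernel P isolates the coefficient of m_P. *)
Lemma ncm_free (a : setpart n -> rat) :
  \sum_P a P *: ncm P = 0 -> forall P, a P = 0.
Proof.
move=> a0 P; have [t P_t] := setpart_kernel P.
have -> : P = kerpart (tnth [tuple t i | i < n]).
  by rewrite P_t; apply: setpart_ext => i j; rewrite !same_block_kerpart !tnth_mktuple.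
move: [tuple t i | i < n] => u.
have <- : (\sum_Q a Q *: ncm Q) u = 0 by rewrite a0.
rewrite ncseries_sum (bigD1 (kerpart (tnth u))) //= big1 => [|Q /negbTE neqQ].
  by rewrite addr0 ncseriesZ ncm_tuple eqxx mulr1.
by rewrite ncseriesZ ncm_tuple neqQ mulr0.
Qed.

Definition orbpart (s : {perm 'I_n}) : setpart n := kerpart (porbit s).

Lemma same_block_orbpart s j k : same_block (orbpart s) j k = (j \in porbit s k).
Proof. by rewrite same_block_kerpart eq_porbit_mem. Qed.

(** Membership of all orbits in blocks needs checking for one application of s only; the powers
    follow by transitivity. *)
Lemma orbpart_subP P s :
  (block_pairs (orbpart s) \subset block_pairs P) = [forall i, same_block P i (s i)].
Proof.
apply/block_pairs_subP/forallP => [sub i|Ps i j].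
  by apply: sub; rewrite same_block_orbpart porbit_sym (mem_porbit s 1).
rewrite same_block_orbpart porbit_sym => /porbitP[k ->]; rewrite permX.
elim: k => [|k IHk] /=; first exact: same_block_refl.
exact: same_block_trans IHk (Ps _).
Qed.

(** The parity of a permutation depends only on n and on its number of orbits. *)
Lemma orbpart_sign s s' : orbpart s = orbpart s' -> odd_perm s = odd_perm s'.
Proof.
move=> eq_ss'; rewrite /odd_perm; congr (_ (+) odd #|pred_of_set _|).
rewrite /porbits; apply: eq_imset => i; apply/setP => j.
by rewrite -!same_block_orbpart eq_ss'.
Qed.

(** The witness rotates each block cyclically along its enumeration. *)
Lemma orbpart_surj P : exists s, orbpart s = P.
Proof.
pose c i := enum (pblock (val P) i); pose f i := next (c i) i.
have c_f i : c (f i) = c i.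
  have /eqP : pblock (val P) i == pblock (val P) (f i).
    by rewrite -same_block_pblock same_blockE -mem_enum mem_next mem_enum -same_blockE same_block_refl.
  by rewrite /c => ->.
have f_inj : injective f.
  apply: (can_inj (g := fun i => prev (c i) i)) => i.
  by rewrite c_f /f prev_next // enum_uniq.
exists (perm f_inj); apply: setpart_ext => i j.
have c_next : {in c j &, frel f =2 frel (next (c j))}.
  move=> k l; rewrite mem_enum -same_blockE same_block_pblock => /eqP jk _ /=.
  by rewrite /f /c jk.
have cycle_f : fcycle f (c j).
  by rewrite (eq_in_cycle c_next) ?cycle_next ?enum_uniq //; apply/allP.
have j_c : j \in c j by rewrite mem_enum -same_blockE same_block_refl.
rewrite same_block_orbpart [RHS]same_block_sym same_blockE -[RHS]mem_enum.
rewrite -/(c j) -(fconnect_cycle cycle_f j_c).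
have iter_f k : iter k (perm f_inj) j = iter k f j.
  by elim: k => //= k ->; rewrite permE.
apply/porbitP/idP => [[k ->]|/iter_findex <-].
  by rewrite permX iter_f fconnect_iter.
by exists (findex f j i); rewrite permX iter_f.
Qed.

(* If t j = t k with j and k in the same block, then left multiplication by    *)
(* the transposition (j k) is a sign-reversing involution on the permutations  *)
(* that contribute to the sum.                                                 *)
Lemma perm_expansion P (t : 'I_n -> nat) :
  [forall j, forall k, (j != k) && same_block P j k ==> (t j != t k)]%:R =
  \sum_(s : {perm 'I_n} | block_pairs (orbpart s) \subset block_pairs P)
    (-1) ^+ s * (block_pairs (orbpart s) \subset block_pairs (kerpart t))%:R :> rat.
Proof.
have [/forallP inj|] := boolP [forall j, forall k,
    (j != k) && same_block P j k ==> (t j != t k)].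
  (* If t is injective on the blocks, only the identity contributes: i and s i share a block and a
     value of t, so s i = i. *)
  rewrite (bigD1 1%g) /=; last first.
    by rewrite orbpart_subP; apply/forallP => i; rewrite perm1 same_block_refl.
  rewrite odd_perm1 mul1r big1 => [|s /andP[]].
    rewrite addr0 orbpart_subP (introT forallP) // => i.
    by rewrite perm1 same_block_refl.
  rewrite !orbpart_subP => /forallP Ps s1; case: forallP => [ts|]; last by rewrite mulr0.
  case/eqP: s1; apply/permP => i; rewrite perm1; apply/eqP/contraT => si.
  have /forallP/(_ (s i)) := inj i; rewrite eq_sym si Ps /=.
  by have := ts i; rewrite same_block_kerpart => /eqP->; rewrite eqxx.
rewrite negb_forall => /existsP[j]; rewrite negb_forall => /existsP[k].
rewrite negb_imply negbK => /andP[/andP[neq_jk Pjk] /eqP tjk].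
set S := \sum_(s | _) _.
have cond_tperm Q s : same_block Q j k ->
    (block_pairs (orbpart (tperm j k * s)%g) \subset block_pairs Q) =
    (block_pairs (orbpart s) \subset block_pairs Q).
  move=> Qjk.
  suff imp u : block_pairs (orbpart u) \subset block_pairs Q ->
      block_pairs (orbpart (tperm j k * u)%g) \subset block_pairs Q.
    by apply/idP/idP => [/imp|/imp//]; rewrite mulgA tperm2 mul1g.
  rewrite !orbpart_subP => /forallP Qu; apply/forallP => i; rewrite permM.
  apply: same_block_trans (Qu _); case: tpermP => [->|->|_ _] //.
  - by rewrite same_block_sym.
  - exact: same_block_refl.
have S_opp : S = - S.
  rewrite {1}/S (reindex_inj (mulgI (tperm j k))) -sumrN /=.
  apply: eq_big => [s|s _]; first exact: cond_tperm.
  rewrite cond_tperm ?same_block_kerpart ?tjk //.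
  by rewrite odd_permM odd_tperm neq_jk signr_addb expr1 mulN1r mulNr.
suff -> : S = 0 by [].
by have /eqP := S_opp; rewrite -addr_eq0 -mulr2n mulrn_eq0 /= => /eqP.
Qed.

Definition nce_coef P Q : rat :=
  \sum_(s : {perm 'I_n} | (block_pairs (orbpart s) \subset block_pairs P) && (orbpart s == Q))
    (-1) ^+ s.

Lemma nce_ncp P : nce P = \sum_Q nce_coef P Q *: ncp Q.
Proof.
apply: homogeneous_ext; [exact: nce_homogeneous | |] => [|t].
  by apply: homogeneous_sum => Q; apply: ncp_homogeneous.
rewrite /nce tuple_series_tuple perm_expansion ncseries_sum.
rewrite (partition_big orbpart xpredT) //=; apply: eq_bigr => Q _.
rewrite ncseriesZ /ncp tuple_series_tuple mulr_suml.
by apply: eq_bigr => s /andP[_ /eqP->].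
Qed.

(** All terms carry the same sign and there is at least one, so nothing cancels over the
    rationals. *)
Lemma nce_coef_diag P : nce_coef P P != 0.
Proof.
have [s0 s0P] := orbpart_surj P; rewrite /nce_coef.
rewrite (eq_bigr (fun=> (-1) ^+ odd_perm s0)); last first.
  by move=> s /andP[_ /eqP sP]; rewrite (@orbpart_sign s s0) // sP s0P.
rewrite sumr_const mulrn_eq0 negb_or signr_eq0 andbT -lt0n.
by apply/card_gt0P; exists s0; rewrite unfold_in s0P eqxx fintype.subxx.
Qed.

Lemma nce_coef_triangular P Q :
  nce_coef P Q != 0 -> block_pairs Q \subset block_pairs P.
Proof.
apply: contraR => nsub; rewrite /nce_coef big1 // => s /andP[sub /eqP sQ].
by rewrite -sQ sub in nsub.
Qed.

End Series.

(** * Triangular families *)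

Section Triangular.
Context {F : fieldType} {V : lmodType F} {T : finType}.
Implicit Types (u v : T -> V) (z : V).

Definition in_span v z := exists b : T -> F, z = \sum_x b x *: v x.

Definition lin_free v := forall a : T -> F, \sum_x a x *: v x = 0 -> forall x, a x = 0.

Lemma in_span0 v : in_span v 0.
Proof. by exists (fun=> 0); rewrite big1 // => x _; rewrite scale0r. Qed.

Lemma in_spanD v z1 z2 : in_span v z1 -> in_span v z2 -> in_span v (z1 + z2).
Proof.
move=> [b1 ->] [b2 ->]; exists (fun x => b1 x + b2 x).
by rewrite -big_split; apply: eq_bigr => x _; rewrite scalerDl.
Qed.

Lemma in_spanZ v a z : in_span v z -> in_span v (a *: z).
Proof.
move=> [b ->]; exists (fun x => a * b x).
by rewrite scaler_sumr; apply: eq_bigr => x _; rewrite scalerA.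
Qed.

Lemma in_span_sum (I : Type) (r : seq I) (p : pred I) v (G : I -> V) :
  (forall i, p i -> in_span v (G i)) -> in_span v (\sum_(i <- r | p i) G i).
Proof. by move=> vG; apply: big_ind => //; [apply: in_span0 | apply: in_spanD]. Qed.

Lemma in_span_id v x : in_span v (v x).
Proof.
exists (fun y => (y == x)%:R); rewrite (bigD1 x) //= eqxx scale1r big1 ?addr0 //.
by move=> y /negbTE->; rewrite scale0r.
Qed.

Lemma in_span_trans u v z : (forall x, in_span v (u x)) -> in_span u z -> in_span v z.
Proof. by move=> vu [b ->]; apply: in_span_sum => x _; apply: in_spanZ. Qed.

Context (rk : T -> nat) (M : T -> T -> F) (u v : T -> V).
Context (v_def : forall x, v x = \sum_y M x y *: u y).
Context (M_diag : forall x, M x x != 0).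
Context (M_lower : forall x y, M x y != 0 -> x != y -> (rk y < rk x)%N).

(** Induction on the rank: solve the defining equation of v x for u x, the other terms having
    smaller rank. *)
Lemma triangular_span x : in_span v (u x).
Proof.
have [n] := ubnP (rk x); elim: n x => // n IHn x; rewrite ltnS => le_xn.
have -> : u x = (M x x)^-1 *: (v x - \sum_(y | y != x) M x y *: u y).
  by rewrite v_def (bigD1 x) //= addrK scalerA mulVf // scale1r.
apply/in_spanZ/in_spanD; first exact: in_span_id.
rewrite -scaleN1r; apply/in_spanZ/in_span_sum => y neq_yx.
have [->|Mxy] := eqVneq (M x y) 0; first by rewrite scale0r; apply: in_span0.
apply/in_spanZ/IHn/(leq_trans _ le_xn)/M_lower => //.
by rewrite eq_sym.
Qed.

(** Take x of maximal rank with a x nonzero. In the relation rewritten in terms of u, the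
    coefficient of u x is then just a x times the diagonal entry. *)
Lemma triangular_free : lin_free u -> lin_free v.
Proof.
move=> u_free a av x0; apply/eqP/contraT => ax0.
pose P := [pred x | a x != 0].
have [x ax max_x] := @arg_maxnP _ x0 P rk ax0.
have col0 y : \sum_z a z * M z y = 0.
  move: y; apply: u_free; rewrite -[RHS]av.
  under eq_bigr => y _ do rewrite scaler_suml.
  rewrite exchange_big; apply: eq_bigr => z _.
  rewrite v_def scaler_sumr; apply: eq_bigr => y _.
  by rewrite scalerA.
have := col0 x; rewrite (bigD1 x) //= big1 ?addr0 => [/eqP|z neq_zx].
  by rewrite mulf_eq0 (negbTE (M_diag x)) orbF => /eqP ax0'; rewrite /= ax0' eqxx in ax.
have [->|az] := eqVneq (a z) 0; first by rewrite mul0r.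
have [->|Mzx] := eqVneq (M z x) 0; first by rewrite mulr0.
by have := M_lower Mzx neq_zx; rewrite ltnNge; have /= -> := max_x z az.
Qed.

End Triangular.

(** * The e_P as a basis in each degree *)

Section Bases.
Context {n : nat}.
Implicit Types P Q : setpart n.

(** Here p_P involves coarser partitions, so the rank counts the pairs not in a common block; for
    e_P in terms of p the order is the opposite. *)
Let ncp_lower P Q : (block_pairs P \subset block_pairs Q)%:R != 0 :> rat -> P != Q ->
  (#|~: block_pairs Q| < #|~: block_pairs P|)%N.
Proof.
rewrite pnatr_eq0 eqb0 negbK => sub neq; have := block_pairs_proper sub neq.
by have := cardsC (block_pairs P); have := cardsC (block_pairs Q); lia.
Qed.

Let ncp_diag P : (block_pairs P \subset block_pairs P)%:R != 0 :> rat.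
Proof. by rewrite fintype.subxx oner_eq0. Qed.

Let nce_lower P Q : nce_coef P Q != 0 -> P != Q ->
  (#|block_pairs Q| < #|block_pairs P|)%N.
Proof.
by move=> /nce_coef_triangular sub neq; apply: block_pairs_proper; rewrite // eq_sym.
Qed.

Lemma nce_free : lin_free (@nce n).
Proof.
apply: (triangular_free nce_ncp nce_coef_diag nce_lower).
apply: (triangular_free ncp_ncm ncp_diag ncp_lower).
exact: ncm_free.
Qed.

Lemma ncm_in_span_nce P : in_span (@nce n) (ncm P).
Proof.
apply: in_span_trans (triangular_span ncp_ncm ncp_diag ncp_lower P).
exact: (triangular_span nce_ncp nce_coef_diag nce_lower).
Qed.

Lemma nce_NCSym_deg P : NCSym_deg n (nce P).
Proof.
(* [NCSym_deg n] unfolds to [in_span] of the family [ncm]. *)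
apply: (@in_span_trans _ _ _ ncp); last by exists (nce_coef P); apply: nce_ncp.
by move=> Q; exists (fun R => (block_pairs Q \subset block_pairs R)%:R); apply: ncp_ncm.
Qed.

End Bases.

(** * The free algebra on the atomic set partitions *)

Lemma nce0 (P : setpart 0) : nce P = 1.
Proof.
rewrite -(ncm0 P); apply: homogeneous_ext => [||t].
- exact: nce_homogeneous.
- exact: ncm_homogeneous.
- by rewrite /nce /ncm !tuple_series_tuple !(introT forallP) // => -[].
Qed.

(** No block of the slash product meets both halves of the positions, so the condition on a
    concatenated tuple is the conjunction of the conditions on its two pieces. *)
Lemma nce_slash n m (P : setpart n) (Q : setpart m) :
  nce (slash P Q) = nce P * nce Q.
Proof.
apply: homogeneous_ext => [||t]; first exact: nce_homogeneous.
  by apply: homogeneous_mul; apply: nce_homogeneous.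
have szl : size (take n t) == n by rewrite size_takel // size_tuple leq_addr.
have szr : size (drop n t) == m by rewrite size_drop size_tuple addKn.
have -> : t = [tuple of Tuple szl ++ Tuple szr] by apply: val_inj; rewrite /= cat_take_drop.
move: (Tuple szl) (Tuple szr) => {szl szr t} u v.
rewrite (homogeneous_mul_cat _ _ (nce_homogeneous P)) ?size_tuple //.
rewrite /nce !tuple_series_tuple -natrM mulnb; congr (nat_of_bool _)%:R.
apply/idP/andP => [/forallP inj|[/forallP injP /forallP injQ]].
  split; apply/forallP => j; apply/forallP => k.
    have /forallP/(_ (lshift m k)) := inj (lshift m j).
    by rewrite same_block_slash !(unsplitK (inl _)) !tnth_lshift eq_lshift.
  have /forallP/(_ (rshift n k)) := inj (rshift n j).
  by rewrite same_block_slash !(unsplitK (inr _)) !tnth_rshift eq_rshift.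
apply/forallP => j; apply/forallP => k; rewrite same_block_slash.
case: splitP => j' jj'; case: splitP => k' kk'; rewrite ?andbF //.
- have -> : j = lshift m j' by apply: val_inj.
  have -> : k = lshift m k' by apply: val_inj.
  by rewrite !tnth_lshift eq_lshift; apply: (forallP (injP j')).
- have -> : j = rshift n j' by apply: val_inj.
  have -> : k = rshift n k' by apply: val_inj.
  by rewrite !tnth_rshift eq_rshift; apply: (forallP (injQ j')).
Qed.

Lemma word_prod_nce (w : {fmonom atomic_setpart}) :
  word_prod nce_atomic w = nce (tagged (slash_word w)).
Proof.
rewrite /word_prod; elim: (w : seq _) => [|a v IHv] /=; first by rewrite big_nil nce0.
by rewrite big_cons IHv nce_slash.
Qed.

Definition atomic_word (s : any_setpart) : {fmonom atomic_setpart} :=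
  FMonom (sval (cid (slash_word_surj s))).

Lemma atomic_wordK s : slash_word (atomic_word s) = s.
Proof. exact: svalP (cid (slash_word_surj s)). Qed.

Lemma atomic_word_inj : injective atomic_word.
Proof. by move=> s t eq_st; rewrite -(atomic_wordK s) eq_st atomic_wordK. Qed.

Lemma slash_wordK (w : {fmonom atomic_setpart}) : atomic_word (slash_word w) = w.
Proof. by apply/val_inj/slash_word_inj; rewrite atomic_wordK. Qed.

(** On words of length n only monomials whose slash product partitions n points survive. This makes
    each degree a finite linear combination of the e_P with the coefficients of p. *)
Lemma free_alg_eval_tuple (p : free_alg rat atomic_setpart) n (t : n.-tuple nat) :
  free_alg_eval nce_atomic p t =
  (\sum_(P : setpart n) p@_(atomic_word (Tagged setpart P)) *: nce P) t.
Proof.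
have letter (w : {fmonom atomic_setpart}) : nce (tagged (slash_word w)) t =
    \sum_(P : setpart n) (w == atomic_word (Tagged setpart P))%:R * nce P t.
  under eq_bigr => P _ do rewrite -[w in w == _]slash_wordK.
  case: (slash_word w) => m Q /=.
  have [mn|neq] := eqVneq m n; last first.
    rewrite nce_homogeneous ?size_tuple 1?eq_sym // big1 // => P _.
    rewrite (inj_eq atomic_word_inj) -tag_eqE /tag_eq /=.
    by rewrite (negbTE neq) mul0r.
  case: n / mn t => t; rewrite (bigD1 Q) //= eqxx mul1r big1 ?addr0 // => P neq.
  by rewrite (inj_eq atomic_word_inj) eq_Tagged /= eq_sym (negbTE neq) mul0r.
rewrite /free_alg_eval !ncseries_sum.
transitivity (\sum_(w <- msupp p) \sum_(P : setpart n)
    p@_w * ((w == atomic_word (Tagged setpart P))%:R * nce P t)).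
  apply: eq_bigr => w _.
  by rewrite -mulr_sumr -letter -word_prod_nce.
rewrite exchange_big; apply: eq_bigr => P _ /=.
(* The indicator selects from the support of p the coefficient at this word, and gives 0, still the
   coefficient, if the word is outside the support. *)
rewrite ncseriesZ; under eq_bigr => w _ do rewrite mulrA mulr_natr -mcoeffU.
by rewrite -mulr_suml -raddf_sum -monalgE.
Qed.

(** Every word is the factorization of some partition P of n, so its coefficient in p is that of e_P
    in degree n, which [nce_free] kills. *)
Lemma nce_atomic_independent : nc_alg_independent nce_atomic.
Proof.
move=> p p0; apply/malgP => w; rewrite mcoeff0 -(slash_wordK w).
case: (slash_word w) => n P; move: P; apply: nce_free.
apply: homogeneous_ext => [||t].
- by apply: homogeneous_sum => P; apply: nce_homogeneous.
- by [].
- by rewrite -free_alg_eval_tuple p0.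
Qed.

(** * The image of the evaluation map *)

Lemma NCSym_deg0 n : NCSym_deg n 0.
Proof. exact: in_span0. Qed.

Lemma NCSymD f g : NCSym f -> NCSym g -> NCSym (f + g).
Proof.
move=> [N [u [u_deg ->]]] [N' [u' [u'_deg ->]]]; exists (N + N')%N.
(* Each family is cut off at its own bound, so extending its sum to N + N' adds only zeros. *)
exists (fun n => (if (n < N)%N then u n else 0) + (if (n < N')%N then u' n else 0)).
split=> [n|].
  by apply: in_spanD; case: ifP => _; [apply: u_deg | | apply: u'_deg |]; apply: NCSym_deg0.
rewrite big_split -!big_mkcond /=.
by rewrite -!big_ord_widen // ?leq_addr ?leq_addl.
Qed.

Lemma NCSym_degW n f : NCSym_deg n f -> NCSym f.
Proof.
move=> f_deg; exists n.+1, (fun m => if m == n then f else 0); split=> [m|].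
  by case: eqP => [->//|_]; apply: NCSym_deg0.
rewrite big_ord_recr /= eqxx big1 ?add0r // => i _.
by rewrite ltn_eqF.
Qed.

Lemma NCSym0 : NCSym 0.
Proof. exact: NCSym_degW (NCSym_deg0 0). Qed.

Lemma free_alg_eval_NCSym p : NCSym (free_alg_eval nce_atomic p).
Proof.
rewrite /free_alg_eval; apply: big_ind => [||w _]; [exact: NCSym0 | exact: NCSymD |].
apply: (@NCSym_degW (tag (slash_word w))); apply: in_spanZ.
by have := word_prod_nce w; rewrite /word_prod => ->; apply: nce_NCSym_deg.
Qed.

HB.instance Definition _ (g : atomic_setpart -> ncseries) :=
  GRing.isLinear.Build rat (free_alg rat atomic_setpart) ncseries _
    (free_alg_eval g) (free_alg_eval_is_linear g).

(** The image is closed under sums, and each homogeneous component is a combination of the e_P,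
    which are images of monomials. *)
Lemma NCSym_free_alg_eval f : NCSym f -> exists p, free_alg_eval nce_atomic p = f.
Proof.
move=> [N [g [g_deg ->]]].
pose img h := exists p, free_alg_eval nce_atomic p = h.
have img0 : img 0 by exists 0; rewrite linear0.
have imgD h k : img h -> img k -> img (h + k).
  by move=> [p <-] [q <-]; exists (p + q); rewrite linearD.
apply: (big_ind img) => // n _.
have [b ->] : in_span (@nce n) (g n) := in_span_trans ncm_in_span_nce (g_deg n).
apply: (big_ind img) => // P _.
exists (<< b P *g atomic_word (Tagged setpart P) >>).
by rewrite free_alg_evalE mmapU /= word_prod_nce atomic_wordK mulr_algl.
Qed.

Theorem theorem4p12 :
  nc_alg_independent nce_atomic /\ nc_freely_generates nce_atomic NCSym.
Proof.
split; first exact: nce_atomic_independent.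
split=> [p _|p q _ _ eq_pq|f /NCSym_free_alg_eval[p <-]].
- exact: free_alg_eval_NCSym.
- apply/eqP; rewrite -subr_eq0; apply/eqP/nce_atomic_independent.
  by rewrite linearB /= eq_pq subrr.
- by exists p.
Qed.
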